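(* Let $(X,d)$ be a locally connected metric space without isolated points and let $\phi_n:X\to X$, $n=1,2,\ldots$, be a sequence of continuous maps. If $(X,\phi_{1,\infty})$ is $\aleph_0$-expansive, then it is meagre-expansive.
   Context: For a sequence of continuous maps $\phi_{1,\infty}=\{\phi_n\}_{n=1}^\infty$ on $X$, write $\phi_1^n=\phi_n\circ\phi_{n-1}\circ\cdots\circ\phi_1$ for $n\ge 1$; here $\mathbb{N}=\{1,2,\ldots\}$. For $c>0$ and $x\in X$ consider the set $\{y\in X: d(\phi_1^i(x),\phi_1^i(y))\le c\text{ for all } i\in\mathbb{N}\}$. The system $(X,\phi_{1,\infty})$ is $\aleph_0$-expansive if there is $c>0$ such that this set is at most countable for every $x\in X$. It is meagre-expansive if there is $c>0$ such that this set is nowhere dense (its closure has empty interior) for every $x\in X$. *)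

(* Defs.v *)
From mathcomp Require Import all_boot all_order all_algebra.
From mathcomp Require Import all_classical all_reals all_analysis.

Set Implicit Arguments.
Unset Strict Implicit.
Unset Printing Implicit Defensive.

Import Order.TTheory GRing.Theory Num.Theory.
Local Open Scope classical_set_scope.
Local Open Scope ring_scope.

Definition locally_connected (T : topologicalType) : Prop :=
  forall (x : T) (U : set T), nbhs x U ->
    exists V : set T, [/\ open V, V x, connected V & V `<=` U].

Definition nowhere_dense (T : topologicalType) (A : set T) : Prop :=
  interior (closure A) = set0.

(* Sequences of maps are numbered from 1: the value phi 0 is never used, and
   iter_seq phi n = phi n \o ... \o phi 1, with iter_seq phi 0 = id. *)
Fixpoint iter_seq (T : Type) (phi : nat -> T -> T) (n : nat) : T -> T :=
  if n is m.+1 then phi n \o iter_seq phi m else id.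

(* The times i start at 1, so mdist x y itself is not constrained. *)
Definition shadow_set (R : realType) (X : metricType R)
    (phi : nat -> X -> X) (c : R) (x : X) : set X :=
  [set y | forall i : nat, (1 <= i)%N ->
     mdist (iter_seq phi i x) (iter_seq phi i y) <= c].

Definition aleph0_expansive (R : realType) (X : metricType R)
    (phi : nat -> X -> X) : Prop :=
  exists2 c : R, 0 < c & forall x : X, countable (shadow_set phi c x).

Definition meagre_expansive (R : realType) (X : metricType R)
    (phi : nat -> X -> X) : Prop :=
  exists2 c : R, 0 < c & forall x : X, nowhere_dense (shadow_set phi c x).

(* Main.v *)
(** The same constant works for both notions.  Shadow sets are closed, so one
    that is not nowhere dense contains a nonempty open connected set V, which is
    countable.  For x in V, the distance to x maps V onto a countable interval
    containing 0, so V = {x}, making x an isolated point. *)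
Require Import Defs.
From mathcomp Require Import all_boot all_order all_algebra.
From mathcomp Require Import all_classical all_reals all_analysis.

Import Order.TTheory GRing.Theory Num.Theory.
Import numFieldNormedType.Exports.

Local Open Scope classical_set_scope.
Local Open Scope ring_scope.

(** The distance to [x] is 1-Lipschitz, by the triangle inequality through [z] for one bound and
    through [y] for the other. *)
Lemma continuous_mdist (R : realType) (X : metricType R) (x : X) :
  continuous (mdist x : X -> R).
Proof.
move=> y; apply/cvgrPdist_lt => e e0.
near=> z.
have zy : mdist y z < e.
  near: z; exact: (@metricType_numDomainType.cvgr_dist_lt _ _ _ _ _ id y).
rewrite ltr_distlC; apply/andP; split.
- rewrite ltrBlDr (le_lt_trans (metric_triangle x z y))// ltrD2l.
  by rewrite metric_sym.
- by rewrite (le_lt_trans (metric_triangle x y z))// ltrD2l.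
Unshelve. all: by end_near. Qed.

(** Countable sets are Lebesgue-null, whereas this interval has measure [r]. *)
Lemma not_countable_itv (R : realType) (r : R) :
  0 < r -> ~ countable [set t : R | 0 <= t <= r].
Proof.
move=> r0 /countable_lebesgue_measure0.
have -> : [set t : R | 0 <= t <= r] = `[0, r]%classic.
  by apply/seteqP; split=> t /=; rewrite in_itv.
rewrite lebesgue_measure_itv /= lte_fin r0 oppr0 adde0 => -[] r00.
by rewrite r00 ltxx in r0.
Qed.

Lemma countable_connected_subset1 (R : realType) (X : metricType R)
    (V : set X) (x y : X) :
  connected V -> countable V -> V x -> V y -> x = y.
Proof.
move=> cV countV Vx Vy; apply: contrapT => /eqP; rewrite -mdist_gt0 => xy0.
apply: (not_countable_itv _ _ xy0).
apply: (@sub_countable _ _ _ V) => //.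
apply: card_le_trans (card_image_le (mdist x) V).
(* It remains to see that every [t] between 0 and [mdist x y] is a distance from [x] to a point of
   [V]: both endpoints are such distances, and the connected image has no gaps. *)
apply: subset_card_le => t /= t0.
have /connected_intervalP dV : connected (mdist x @` V).
  apply: connected_continuous_connected => //.
  exact/continuous_subspaceT/continuous_mdist.
apply: (dV (mdist x x) (mdist x y)) ; [by exists x|by exists y|].
by rewrite mdistxx.
Qed.

Lemma continuous_iter_seq (T : topologicalType) (phi : nat -> T -> T) (n : nat) :
  (forall m, (1 <= m)%N -> continuous (phi m)) -> continuous (iter_seq phi n).
Proof.
move=> hphi; elim: n => [|n IH] x; first exact: cvg_id.
by apply: continuous_comp; [exact: IH|exact: hphi].
Qed.

(** Each time [i] contributes a closed condition, the preimage of a closed half-line under a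
    continuous function, and the shadow set is the intersection of these conditions. *)
Lemma closed_shadow_set (R : realType) (X : metricType R)
    (phi : nat -> X -> X) (c : R) (x : X) :
  (forall n, (1 <= n)%N -> continuous (phi n)) -> closed (shadow_set phi c x).
Proof.
move=> hphi.
rewrite [X in closed X](_ : _ = \bigcap_(i in [set i | (1 <= i)%N])
    ((mdist (iter_seq phi i x) \o iter_seq phi i) @^-1` [set t | t <= c])) //.
apply: closed_bigI => i _; apply: preimage_closed; last exact: closed_le.
move=> y _; apply: continuous_comp; last exact: continuous_mdist.
exact: continuous_iter_seq.
Qed.

Theorem corollary4p3 (R : realType) (X : metricType R) (phi : nat -> X -> X)
  (hX : locally_connected X)
  (hiso : isolated [set: X] = set0)
  (hphi : forall n : nat, (1 <= n)%N -> continuous (phi n)) :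
  aleph0_expansive phi -> meagre_expansive phi.
Proof.
move=> [c c0 countS]; exists c => // x; rewrite /nowhere_dense.
have /closure_id <- := closed_shadow_set _ _ phi c x hphi.
rewrite -subset0 => y /hX[V [oV Vy cV VS]].
have countV : countable V := sub_countable (subset_card_le VS) (countS x).
(* The absurd goal [set0 y] becomes the claim that [y] is isolated in the whole space, witnessed by
   the neighbourhood [V], which reduces to the single point [y]. *)
rewrite -hiso; split; first by rewrite inE.
exists V; first exact: open_nbhs_nbhs.
rewrite setIT; apply/seteqP; split=> [z Vz /=|z -> //].
exact: (countable_connected_subset1 _ _ V).
Qed.
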